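(* Let $\lambda$ be a limit ordinal. For every formula $\varphi$ the following are equivalent. (d1) $\mathbf{D}_{\rm H} \vdash \varphi$. (d2) $\varphi$ is true at the bottom of any constant $\lambda$-extension of any GL-model. (d3) $\varphi$ is true at the bottom of any $\lambda$-extension of any GL-model.
   Context: Formulas are built from propositional variables (the set of which is PropVar) and $\bot$ by $\to$ and $\Box$; other connectives are the usual classical abbreviations. Hilbert systems. $\mathbf{GL}_{\rm H}$: axioms are all tautologies, $\Box(\varphi\to\psi)\to(\Box\varphi\to\Box\psi)$, $\Box(\Box\varphi\to\varphi)\to\Box\varphi$; rules are modus ponens and necessitation (from $\varphi$ infer $\Box\varphi$). $\mathbf{D}_{\rm H}$: axioms are all theorems of $\mathbf{GL}_{\rm H}$, $\neg\Box\bot$, and all $\Box(\Box\varphi\lor\Box\psi)\to\Box\varphi\lor\Box\psi$; the only rule is modus ponens. Kripke semantics. A Kripke model $\langle W,\prec,V\rangle$ consists of a non-empty set $W$, a relation $\prec\subseteq W\times W$ and $V:W\times\mathrm{PropVar}\to\{\mathsf{true},\mathsf{false}\}$, extended to all formulas as usual, with $V(w,\Box\varphi)=\mathsf{true}$ iff $V(w',\varphi)=\mathsf{true}$ for all $w'$ with $w\prec w'$. $\varphi$ is true at $w$ if $V(w,\varphi)=\mathsf{true}$. A GL-frame is a frame $\langle W,\prec\rangle$ with $\prec$ transitive and converse well-founded (no infinite sequence $x_1\prec x_2\prec\cdots$); a GL-model is a model based on a GL-frame. $\lambda$-extensions. For a limit ordinal $\lambda$, $\langle W^+,\prec^+\rangle$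 is a $\lambda$-extension of a frame $\langle W,\prec\rangle$ if for some $t_0\in W$: $W^+=W\uplus\{t_\alpha\mid 0<\alpha\le\lambda\}$ (disjoint union, the $t_\alpha$ distinct) and $\prec^+ = \prec\cup\{(t_\alpha,t_\beta)\mid 0\le\beta<\alpha\le\lambda\}\cup\{(t_\alpha,x)\mid 0<\alpha\le\lambda,\ t_0\prec x\}$. The set $\{t_\alpha\mid 0<\alpha<\lambda\}$ is the tail and $t_\lambda$ is the bottom. A model $\langle W^+,\prec^+,V^+\rangle$ is a $\lambda$-extension of $\langle W,\prec,V\rangle$ if its frame is a $\lambda$-extension of $\langle W,\prec\rangle$ and $V^+$ coincides with $V$ on $W$. It is constant if $V^+(t_\alpha,p)=V^+(t_\beta,p)$ for all $p\in\mathrm{PropVar}$ and all $\alpha,\beta<\lambda$ (including index $0$). *)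

(* Defs.v *)
From Stdlib Require Import Relation_Definitions.

Set Implicit Arguments.
Unset Strict Implicit.
Unset Printing Implicit Defensive.

Inductive formula (PropVar : Type) : Type :=
| Var (p : PropVar)
| Bot
| Imp (phi psi : formula PropVar)
| Box (phi : formula PropVar).

Arguments Bot {PropVar}.

Definition Neg {PropVar : Type} (phi : formula PropVar) : formula PropVar :=
  Imp phi Bot.

Definition Or {PropVar : Type} (phi psi : formula PropVar) : formula PropVar :=
  Imp (Neg phi) psi.

(* Classical propositional evaluation, where variables and boxed formulas are
   the atoms. *)
Fixpoint prop_eval {PropVar : Type} (v : formula PropVar -> bool)
    (phi : formula PropVar) : bool :=
  match phi with
  | Bot => false
  | Imp psi chi => implb (prop_eval v psi) (prop_eval v chi)
  | Var _ | Box _ => v phi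
  end.

Definition tautology {PropVar : Type} (phi : formula PropVar) : Prop :=
  forall v, prop_eval v phi = true.

Inductive GL_H {PropVar : Type} : formula PropVar -> Prop :=
| GL_taut phi : tautology phi -> GL_H phi
| GL_K phi psi : GL_H (Imp (Box (Imp phi psi)) (Imp (Box phi) (Box psi)))
| GL_Lob phi : GL_H (Imp (Box (Imp (Box phi) phi)) (Box phi))
| GL_mp phi psi : GL_H (Imp phi psi) -> GL_H phi -> GL_H psi
| GL_nec phi : GL_H phi -> GL_H (Box phi).

Inductive D_H {PropVar : Type} : formula PropVar -> Prop :=
| D_GL phi : GL_H phi -> D_H phi
| D_con : D_H (Neg (Box Bot))
| D_disj phi psi :
    D_H (Imp (Box (Or (Box phi) (Box psi))) (Or (Box phi) (Box psi)))
| D_mp phi psi : D_H (Imp phi psi) -> D_H phi -> D_H psi.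

Record frame : Type := Frame {
  world :> Type;
  world_nonempty : inhabited world;
  acc : relation world
}.

Record model (PropVar : Type) : Type := Model {
  model_frame :> frame;
  val : model_frame -> PropVar -> bool
}.

Fixpoint true_at {PropVar : Type} (M : model PropVar) (w : M)
    (phi : formula PropVar) : Prop :=
  match phi with
  | Var p => val w p = true
  | Bot => False
  | Imp psi chi => true_at w psi -> true_at w chi
  | Box psi => forall w' : M, acc w w' -> true_at w' psi
  end.

Definition GL_frame (F : frame) : Prop :=
  transitive F (@acc F) /\
  ~ exists x : nat -> F, forall n, acc (x n) (x (S n)).

(* A limit ordinal lambda, given up to isomorphism by the well-ordered type of
   the ordinals below it; it is nonzero because it contains [ord_zero]. *)
Record limit_ordinal : Type := LimitOrdinal {
  ord_below :> Type;
  ord_lt : relation ord_below;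
  ord_lt_wf : well_founded ord_lt;
  ord_lt_trans : transitive ord_below ord_lt;
  ord_lt_total : forall a b, ord_lt a b \/ a = b \/ ord_lt b a;
  ord_zero : ord_below;
  ord_zero_least : forall a, ~ ord_lt a ord_zero;
  ord_no_max : forall a, exists b, ord_lt a b
}.

Arguments ord_zero : clear implicits.

(* The ordinals <= lambda: [Some a] is the ordinal a < lambda, and [None] is
   lambda itself. *)
Definition ord_upto (lambda : limit_ordinal) : Type := option lambda.

Definition upto_zero (lambda : limit_ordinal) : ord_upto lambda :=
  Some (ord_zero lambda).

Definition upto_top (lambda : limit_ordinal) : ord_upto lambda := None.

Definition upto_lt {lambda : limit_ordinal} (a b : ord_upto lambda) : Prop :=
  match a, b with
  | Some a', Some b' => ord_lt a' b'
  | Some _, None => True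
  | None, _ => False
  end.

(* [G] is a lambda-extension of [F]: the disjoint union of an injected copy of
   the worlds of [F] and of the pairwise distinct t_a = [node a], for
   0 < a <= lambda, while t_0 is the world [node0] of [F]. *)
Record frame_extension (lambda : limit_ordinal) (F G : frame) : Type := {
  incl : F -> G;
  node0 : F;
  node : ord_upto lambda -> G;
  node_zero : node (upto_zero lambda) = incl node0;
  incl_inj : forall x x', incl x = incl x' -> x = x';
  node_inj : forall a b, node a = node b -> a = b;
  node_fresh : forall a x, upto_lt (upto_zero lambda) a -> node a <> incl x;
  ext_cover : forall y,
    (exists x, y = incl x) \/
    (exists a, upto_lt (upto_zero lambda) a /\ y = node a);
  ext_acc : forall y z : G, acc y z <->
    (exists x x', acc x x' /\ y = incl x /\ z = incl x') \/
    (exists a b, upto_lt b a /\ y = node a /\ z = node b) \/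
    (exists a x, upto_lt (upto_zero lambda) a /\ acc node0 x /\
       y = node a /\ z = incl x)
}.

Record model_extension (PropVar : Type) (lambda : limit_ordinal)
    (M N : model PropVar) : Type := {
  ext_frame :> frame_extension lambda M N;
  ext_val : forall (x : M) (p : PropVar), val (incl ext_frame x) p = val x p
}.

Definition bottom (lambda : limit_ordinal) (F G : frame)
    (X : frame_extension lambda F G) : G :=
  node X (upto_top lambda).

Definition constant_extension (PropVar : Type) (lambda : limit_ordinal)
    (M N : model PropVar) (X : model_extension lambda M N) : Prop :=
  forall (p : PropVar) (a b : ord_upto lambda),
    upto_lt a (upto_top lambda) -> upto_lt b (upto_top lambda) ->
    val (node X a) p = val (node X b) p.

(* Main.v *)
From Stdlib Require Import List ClassicalEpsilon Relation_Definitions Lia.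
Require Import Defs.

(** Soundness holds because any two worlds seen from [t_lambda] are already
    seen from some [t_gamma] with [gamma < lambda], so a world refuting
    [Box phi] and one refuting [Box psi] yield a [t_gamma] refuting
    [Or (Box phi) (Box psi)].

    For completeness, if D does not prove [phi], extend D to a theory [w] that
    omits [phi] and decides every subformula of [phi]. Since [w] contains
    [Box (Box a_1 \/ ... \/ Box a_n) -> Box a_1 \/ ... \/ Box a_n], where
    [Box a_1, ..., Box a_n] are the boxed subformulas outside [w], some
    successor [v] of [w] has the same boxed subformulas as [w], and it contains
    [a] as soon as it contains [Box a]. In the constant extension of the
    canonical GL-model at [t_0 := v], the tail therefore agrees with [v] on the
    subformulas of [phi], and the bottom, valued like [w], refutes [phi]. *)

Set Implicit Arguments.
Unset Strict Implicit.
Unset Printing Implicit Defensive.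
Import ListNotations.

(** * Classical truth values, counting in lists, and truth tables *)

Definition decide (P : Prop) : bool :=
  if excluded_middle_informative P then true else false.

Lemma decide_true (P : Prop) : decide P = true <-> P.
Proof.
  unfold decide; destruct (excluded_middle_informative P); split;
    congruence || tauto.
Qed.

Lemma filter_length_le (A : Type) (f g : A -> bool) (l : list A) :
  (forall a, In a l -> f a = true -> g a = true) ->
  length (filter f l) <= length (filter g l).
Proof.
  induction l as [| a l IH]; simpl; auto; intro H.
  specialize (IH (fun b Hb => H b (or_intror Hb))).
  destruct (f a) eqn:Hf; [rewrite (H a (or_introl eq_refl) Hf); simpl; lia |].
  destruct (g a); simpl; lia.
Qed.

(** The strict decrease that bounds the length of chains in the canonical model. *)
Lemma filter_length_lt (A : Type) (f g : A -> bool) (l : list A) a :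
  (forall b, In b l -> f b = true -> g b = true) ->
  In a l -> f a = false -> g a = true ->
  length (filter f l) < length (filter g l).
Proof.
  intros H Ha Hf Hg; apply in_split in Ha as (l1 & l2 & ->).
  assert (H1 : length (filter f l1) <= length (filter g l1)).
  { apply filter_length_le; intros b Hb; apply H, in_or_app; auto. }
  assert (H2 : length (filter f l2) <= length (filter g l2)).
  { apply filter_length_le; intros b Hb; apply H, in_or_app; simpl; auto. }
  rewrite !filter_app, !length_app; simpl; rewrite Hf, Hg; simpl; lia.
Qed.

(** Formulas that are only metavariables are treated as atoms: the tactic splits on their value
    under [u], which settles whole schemes by truth table. *)
Ltac tautology :=
  let u := fresh "u" in
  intro u; simpl;
  repeat match goal with
    | |- context [prop_eval u ?f] => destruct (prop_eval u f)
    | |- context [u ?f] => destruct (u f)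
  end; reflexivity.

(** * Frames *)

(** A non-accessible point has a non-accessible [R]-successor; iterating a choice of such successors
    would give an infinite chain. *)
Lemma no_chain_wf (A : Type) (R : relation A) :
  ~ (exists x : nat -> A, forall n, R (x n) (x (S n))) ->
  well_founded (fun y z => R z y).
Proof.
  intros Hno a; apply NNPP; intro Ha.
  set (Q := fun y z => R z y) in *.
  assert (step : forall s : {z | ~ Acc Q z},
             {y : {z | ~ Acc Q z} | R (proj1_sig s) (proj1_sig y)}).
  { intros [z Hz]; apply constructive_indefinite_description.
    apply NNPP; intro Hn; apply Hz; constructor; intros y Hy.
    apply NNPP; intro Hy'; apply Hn; exists (exist _ y Hy'); exact Hy. }
  apply Hno.
  exists (fun n => proj1_sig
    (nat_rect _ (exist _ a Ha) (fun _ s => proj1_sig (step s)) n)).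
  intro n; simpl.
  exact (proj2_sig (step _)).
Qed.

(** * Ordinals up to [lambda] and accessibility in a [lambda]-extension *)

Section Extension.
Variables (lambda : limit_ordinal) (F G : frame).
Implicit Types a b c : ord_upto lambda.

Lemma upto_lt_trans a b c : upto_lt a b -> upto_lt b c -> upto_lt a c.
Proof.
  destruct a, b, c; simpl; try tauto. apply ord_lt_trans.
Qed.

Lemma upto_zero_or_pos a : a = upto_zero lambda \/ upto_lt (upto_zero lambda) a.
Proof.
  destruct a as [a|]; simpl; auto.
  destruct (ord_lt_total a (ord_zero lambda)) as [H | [H | H]]; auto.
  - now apply ord_zero_least in H.
  - left; unfold upto_zero; now rewrite H.
Qed.

Lemma upto_lt_pos a b : upto_lt a b -> upto_lt (upto_zero lambda) b.
Proof.
  intro H; destruct (upto_zero_or_pos a) as [-> | Ha]; auto.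
  eapply upto_lt_trans; eauto.
Qed.

Lemma upto_lt_wf : well_founded (@upto_lt lambda).
Proof.
  assert (HS : forall a : lambda, Acc (@upto_lt lambda) (Some a)).
  { intro a; induction a as [a IH] using (well_founded_ind (@ord_lt_wf lambda)).
    constructor; intros [b|] Hb; [now apply IH | contradiction]. }
  intros [a|]; auto.
  constructor; intros [b|] Hb; [auto | contradiction].
Qed.

(** This is where [lambda] being a limit matters: pass to strictly larger ordinals by [ord_no_max]
    and keep the greater one. *)
Lemma upto_join a b :
  upto_lt a (upto_top lambda) -> upto_lt b (upto_top lambda) ->
  exists c, upto_lt c (upto_top lambda) /\ upto_lt a c /\ upto_lt b c.
Proof.
  destruct a as [a|], b as [b|]; simpl; try tauto; intros _ _.
  destruct (ord_no_max a) as [a' Ha], (ord_no_max b) as [b' Hb].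
  destruct (ord_lt_total a' b') as [H | [-> | H]].
  - exists (Some b'); simpl; split; [exact I | split; [| exact Hb]].
    exact (ord_lt_trans Ha H).
  - exists (Some b'); simpl; auto.
  - exists (Some a'); simpl; split; [exact I | split; [exact Ha |]].
    exact (ord_lt_trans Hb H).
Qed.

Variable X : frame_extension lambda F G.

(** The other two clauses of [ext_acc] start at some [t_a] with [a] positive, which is never a world
    of [F]; so old worlds gain no successors. *)
Lemma acc_incl x z :
  acc (incl X x) z <-> exists x', acc x x' /\ z = incl X x'.
Proof.
  rewrite (ext_acc X); split.
  - intros [(y & x' & H & E & ->) | [(a & b & H & E & _) | (a & y & H & _ & E & _)]].
    + apply incl_inj in E as <-; eauto.
    + destruct (node_fresh (upto_lt_pos H) (eq_sym E)).
    + destruct (node_fresh H (eq_sym E)).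
  - intros (x' & H & ->); left; eauto.
Qed.

Lemma acc_node a z : upto_lt (upto_zero lambda) a ->
  acc (node X a) z <->
  (exists b, upto_lt b a /\ z = node X b) \/
  (exists x, acc (node0 X) x /\ z = incl X x).
Proof.
  intro Ha; rewrite (ext_acc X); split.
  - intros [(y & x' & _ & E & _) | [(a' & b & H & E & ->) | (a' & x & _ & H & _ & ->)]].
    + destruct (node_fresh Ha E).
    + apply node_inj in E as <-; eauto.
    + eauto.
  - intros [(b & H & ->) | (x & H & ->)]; right; [left | right]; eauto 6.
Qed.

Lemma acc_node_node a b : upto_lt b a -> acc (node X a) (node X b).
Proof.
  intro H; apply (acc_node _ (upto_lt_pos H)); eauto.
Qed.

(** For [b] zero, the successors of [t_0] are those in [F], and every later node sees them too; for
    [b] positive, the order on ordinals is transitive. *)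
Lemma acc_node_upto a b z :
  upto_lt b a -> acc (node X b) z -> acc (node X a) z.
Proof.
  intros H Hz; apply (acc_node _ (upto_lt_pos H)).
  destruct (upto_zero_or_pos b) as [-> | Hb].
  - rewrite node_zero in Hz; apply acc_incl in Hz; eauto.
  - apply (acc_node _ Hb) in Hz as [(c & Hc & ->) | Hz]; auto.
    left; exists c; split; auto; eapply upto_lt_trans; eauto.
Qed.

Lemma extension_transitive :
  transitive F (@acc F) -> transitive G (@acc G).
Proof.
  intros HF y z u Hyz Hzu.
  destruct (ext_cover X y) as [[x ->] | [a [Ha ->]]].
  - apply acc_incl in Hyz as (x' & H & ->).
    apply acc_incl in Hzu as (x'' & H' & ->).
    apply acc_incl; exists x''; split; [exact (HF _ _ _ H H') | reflexivity].
  - apply (acc_node _ Ha) in Hyz as [(b & Hb & ->) | (x & H & ->)].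
    + exact (acc_node_upto Hb Hzu).
    + apply acc_incl in Hzu as (x' & H' & ->).
      apply acc_node; auto; right; exists x'.
      split; [exact (HF _ _ _ H H') | reflexivity].
Qed.

(** The copy of [F] is closed under successors, so accessibility is settled there first and then
    climbs the nodes by induction on ordinals. *)
Lemma extension_wf :
  well_founded (fun x y : F => acc y x) -> well_founded (fun x y : G => acc y x).
Proof.
  intro HF.
  assert (HI : forall x, Acc (fun x y : G => acc y x) (incl X x)).
  { intro x; induction x as [x IH] using (well_founded_ind HF).
    constructor; intros z Hz; apply acc_incl in Hz as (x' & H & ->); auto. }
  assert (HN : forall a, Acc (fun x y : G => acc y x) (node X a)).
  { intro a; induction a as [a IH] using (well_founded_ind upto_lt_wf).
    destruct (upto_zero_or_pos a) as [-> | Ha].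
    - rewrite node_zero; apply HI.
    - constructor; intros z Hz.
      apply (acc_node _ Ha) in Hz as [(b & Hb & ->) | (x & _ & ->)]; auto. }
  intro y; destruct (ext_cover X y) as [[x ->] | [a [_ ->]]]; auto.
Qed.

Lemma bottom_acc_join y z :
  acc (bottom X) y -> acc (bottom X) z ->
  exists u, acc (bottom X) u /\ acc u y /\ acc u z.
Proof.
  (* Whatever the bottom sees is seen by all nodes beyond some index below [lambda]. *)
  assert (Hbelow : forall y, acc (bottom X) y ->
    exists a, upto_lt a (upto_top lambda) /\
      forall b, upto_lt a b -> acc (node X b) y).
  { intros y' Hy.
    apply acc_node in Hy as [(a & Ha & ->) | (x & Hx & ->)]; [| | exact I].
    - exists a; split; auto; intros b; apply acc_node_node.
    - exists (upto_zero lambda); split; [exact I |].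
      intros b Hb; apply (acc_node _ Hb); eauto. }
  intros Hy Hz.
  apply Hbelow in Hy as (a & Ha & Hy); apply Hbelow in Hz as (b & Hb & Hz).
  destruct (upto_join Ha Hb) as (c & Hc & Hac & Hbc).
  exists (node X c); repeat split; auto; now apply acc_node_node.
Qed.

End Extension.

(** * Soundness *)

Section Soundness.
Variable PropVar : Type.
Implicit Types (M : model PropVar) (phi psi : formula PropVar).

(** Truth at a world is a propositional valuation with boxed formulas as atoms, so every tautology
    is true there. *)
Lemma true_at_prop_eval M (w : M) phi :
  prop_eval (fun psi => decide (true_at w psi)) phi = true <-> true_at w phi.
Proof.
  induction phi as [p | | phi IHphi psi IHpsi | phi _].
  - apply decide_true.
  - simpl; split; [discriminate | tauto].
  - simpl; rewrite <- IHphi, <- IHpsi.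
    destruct prop_eval; destruct prop_eval; simpl; intuition congruence.
  - apply decide_true.
Qed.

Lemma GL_sound M : transitive M (@acc M) ->
  well_founded (fun x y : M => acc y x) ->
  forall phi, GL_H phi -> forall w : M, true_at w phi.
Proof.
  intros Htr Hwf phi H.
  induction H as [phi H | phi psi | phi | phi psi _ IH1 _ IH2 | phi _ IH];
    intro w.
  - apply true_at_prop_eval, H.
  - simpl; intros H1 H2 x Hx; apply (H1 x Hx), H2, Hx.
  - intros H; simpl in H |- *; intros x.
    (* The assumption that [w] sees [x] stays in the goal: successors of [x] inherit it by
       transitivity, which gives [Box phi] at [x]. *)
    induction x as [x IH] using (well_founded_ind Hwf); intro Hx.
    apply (H x Hx); intros y Hy; apply (IH y Hy), (Htr _ _ _ Hx Hy).
  - exact (IH1 w (IH2 w)).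
  - intros x _; apply IH.
Qed.

Lemma D_sound (lambda : limit_ordinal) M (N : model PropVar)
    (X : model_extension lambda M N) phi :
  GL_frame M -> D_H phi -> true_at (bottom X) phi.
Proof.
  intros [Htr Hno] H.
  induction H as [phi H | | phi psi | phi psi _ IH1 _ IH2].
  - apply GL_sound; auto.
    + exact (extension_transitive X Htr).
    + exact (extension_wf X (no_chain_wf Hno)).
  (* The bottom sees [t_0], so [Box Bot] fails there. *)
  - intro H; apply (H (node X (upto_zero lambda))), acc_node_node; exact I.
  - intros H Hphi z Hz; apply NNPP; intro Hnz; apply Hphi; intros y Hy.
    apply NNPP; intro Hny.
    destruct (bottom_acc_join Hy Hz) as (u & Hu & Huy & Huz).
    apply Hnz, (H u Hu); auto.
    intro Hbox; apply Hny, Hbox, Huy.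
  - exact (IH1 IH2).
Qed.

End Soundness.

(** * Theories *)

Section Theories.
Variable PropVar : Type.
Implicit Types (phi psi chi : formula PropVar) (T : formula PropVar -> Prop).
Implicit Types L : list (formula PropVar).

(** Necessitation enters only through theorems of [GL_H], so that [D_H] and the worlds of the
    canonical model are theories as well. *)
Record theory T : Prop := {
  theory_GL : forall phi, GL_H phi -> T phi;
  theory_mp : forall phi psi, T (Imp phi psi) -> T phi -> T psi
}.

Lemma theory_taut T phi : theory T -> tautology phi -> T phi.
Proof. intros HT H; apply HT, GL_taut, H. Qed.

Lemma theory_taut1 T phi psi :
  theory T -> tautology (Imp phi psi) -> T phi -> T psi.
Proof. intros HT H; apply (theory_mp HT), theory_taut; auto. Qed.

Lemma theory_taut2 T phi psi chi :
  theory T -> tautology (Imp phi (Imp psi chi)) -> T phi -> T psi -> T chi.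
Proof. intros HT H H1; apply (theory_mp HT), (theory_taut1 HT H H1). Qed.

Lemma theory_trans T phi psi chi :
  theory T -> T (Imp phi psi) -> T (Imp psi chi) -> T (Imp phi chi).
Proof. intro HT; apply (theory_taut2 HT); tautology. Qed.

Lemma theory_GL_H : theory (@GL_H PropVar).
Proof. split; [auto | apply GL_mp]. Qed.

Lemma theory_D_H : theory (@D_H PropVar).
Proof. split; [apply D_GL | apply D_mp]. Qed.

(** By the deduction theorem this is [T] with [phi] added as an assumption. *)
Lemma theory_assume T phi : theory T -> theory (fun psi => T (Imp phi psi)).
Proof.
  intro HT; split.
  - intros psi H; generalize (theory_GL HT H); apply (theory_taut1 HT); tautology.
  - intros psi chi; apply (theory_taut2 HT); tautology.
Qed.

(** What [T] declares necessary; successors in the canonical model are built by extending this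
    set. *)
Lemma theory_unbox T : theory T -> theory (fun psi => T (Box psi)).
Proof.
  intro HT; split.
  - intros psi H; apply HT, GL_nec, H.
  - intros psi chi H; apply (theory_mp HT); revert H.
    apply (theory_mp HT), HT, GL_K.
Qed.

Lemma GL_box_mono phi psi : GL_H (Imp phi psi) -> GL_H (Imp (Box phi) (Box psi)).
Proof. intro H; eapply GL_mp; [apply GL_K | apply GL_nec, H]. Qed.

(* By Löb's axiom for the conjunction of [phi] and [Box phi]. *)
Lemma GL_4 phi : GL_H (Imp (Box phi) (Box (Box phi))).
Proof.
  set (conj := Neg (Imp phi (Neg (Box phi)))).
  assert (H1 : GL_H (Imp (Box conj) (Box phi))).
  { apply GL_box_mono, GL_taut; tautology. }
  assert (H2 : GL_H (Imp (Box phi) (Box (Imp (Box conj) conj)))).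
  { apply GL_box_mono; revert H1; apply (theory_taut1 theory_GL_H); tautology. }
  apply (theory_trans theory_GL_H H2), (theory_trans theory_GL_H (GL_Lob _)).
  apply GL_box_mono, GL_taut; tautology.
Qed.

Definition box_disj L : formula PropVar :=
  fold_right (fun phi psi => Or (Box phi) psi) Bot L.

Lemma GL_box_disj_4 L : GL_H (Imp (box_disj L) (Box (box_disj L))).
Proof.
  induction L as [| phi L IH]; simpl.
  - apply GL_taut; tautology.
  - assert (H1 : GL_H (Imp (Box phi) (Box (Or (Box phi) (box_disj L))))).
    { apply (theory_trans theory_GL_H (GL_4 _)), GL_box_mono, GL_taut; tautology. }
    assert (H2 : GL_H (Imp (box_disj L) (Box (Or (Box phi) (box_disj L))))).
    { apply (theory_trans theory_GL_H IH), GL_box_mono, GL_taut; tautology. }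
    revert H1 H2; apply (theory_taut2 theory_GL_H); tautology.
Qed.

(** The axiom [D_disj] for any finite number of disjuncts; the empty disjunction is [Bot], where it
    becomes [D_con]. *)
Lemma D_box_disj L : D_H (Imp (Box (box_disj L)) (box_disj L)).
Proof.
  induction L as [| phi L IH]; simpl; [apply D_con |].
  (* Under the outer box, [box_disj L] may be strengthened to its box by [GL_box_disj_4], which
     makes the binary axiom applicable; the induction hypothesis then removes that box. *)
  apply (theory_trans theory_D_H (psi := Box (Or (Box phi) (Box (box_disj L))))).
  - apply D_GL, GL_box_mono; generalize (GL_box_disj_4 L).
    apply (theory_taut1 theory_GL_H); tautology.
  - apply (theory_trans theory_D_H (D_disj _ _)).
    revert IH; apply (theory_taut1 theory_D_H); tautology.
Qed.

Lemma theory_box_disj T L : theory T -> ~ T Bot ->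
  (forall phi, In phi L -> T (Neg (Box phi))) -> ~ T (box_disj L).
Proof.
  intros HT Hbot; induction L as [| phi L IH]; simpl; auto.
  intros Hneg H; apply IH; auto.
  (* [Or] unfolds to an implication from [Neg (Box phi)], so modus ponens drops the refuted
     disjunct. *)
  apply (theory_mp HT H); auto.
Qed.

Lemma box_disj_intro T L phi :
  theory T -> In phi L -> T (Box phi) -> T (box_disj L).
Proof.
  intro HT; induction L as [| psi L IH]; simpl; [tauto |].
  intros [-> | Hin] H.
  - revert H; apply (theory_taut1 HT); tautology.
  - generalize (IH Hin H); apply (theory_taut1 HT); tautology.
Qed.

(** * The canonical model *)

(** Only the finite list [L] is decided, so a theory can be completed in finitely many steps,
    whatever the size of [PropVar]. *)
Record complete_theory L : Type := {
  mem :> formula PropVar -> Prop;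
  mem_theory : theory mem;
  mem_consistent : ~ mem Bot;
  mem_decides : forall phi, In phi L -> mem phi \/ mem (Neg phi)
}.

(** Lindenbaum's lemma, by induction on [L]. Omitting [phi] also ensures consistency. *)
Lemma theory_extend L T phi : theory T -> ~ T phi ->
  exists x : complete_theory L, (forall psi, T psi -> x psi) /\ ~ x phi.
Proof.
  intros HT Hphi.
  enough (exists T', theory T' /\ (forall psi, T psi -> T' psi) /\ ~ T' phi /\
    forall psi, In psi L -> T' psi \/ T' (Neg psi))
    as (T' & HT' & Hsub & Hphi' & Hdec).
  { assert (Hbot : ~ T' Bot).
    { intro H; apply Hphi'; revert H; apply (theory_taut1 HT'); tautology. }
    exists (Build_complete_theory HT' Hbot Hdec); auto. }
  induction L as [| a L (T' & HT' & Hsub & Hphi' & Hdec)].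
  - exists T; simpl; tauto.
  - assert (Hstep : forall b, b = a \/ b = Neg a -> ~ T' (Imp b phi) ->
      exists T'', theory T'' /\ (forall psi, T psi -> T'' psi) /\ ~ T'' phi /\
        forall psi, In psi (a :: L) -> T'' psi \/ T'' (Neg psi)).
    { intros b Hb Hnb.
      assert (Hweak : forall psi, T' psi -> T' (Imp b psi)).
      { intro psi; apply (theory_taut1 HT'); tautology. }
      exists (fun psi => T' (Imp b psi)).
      split; [now apply theory_assume |].
      split; [auto |].
      split; [exact Hnb |].
      intros psi [<- | Hpsi].
      - destruct Hb as [-> | ->]; [left | right];
          apply (theory_taut HT'); tautology.
      - destruct (Hdec _ Hpsi); auto. }
    (* One of [a] and [Neg a] can be added without yielding [phi]; otherwise [T'] would prove [phi]
       by cases. *)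
    destruct (classic (T' (Imp a phi))) as [H1 |]; [| eauto].
    destruct (classic (T' (Imp (Neg a) phi))) as [H2 |]; [| eauto].
    destruct Hphi'; revert H1 H2; apply (theory_taut2 HT'); tautology.
Qed.

Section Canonical.
Variable L : list (formula PropVar).
Implicit Types x y z : complete_theory L.

Lemma mem_Neg x phi : In phi L -> ~ x phi -> x (Neg phi).
Proof. intros H Hn; destruct (mem_decides x H); tauto. Qed.

(** It is enough that the antecedent is decided: [Neg phi] already yields the implication, and [phi]
    brings in [psi]. *)
Lemma mem_Imp x phi psi :
  In phi L -> x (Imp phi psi) <-> (x phi -> x psi).
Proof.
  intro Hin; split.
  - apply (theory_mp (mem_theory x)).
  - intro H; destruct (mem_decides x Hin) as [Hphi | Hphi].
    + generalize (H Hphi); apply (theory_taut1 (mem_theory x)); tautology.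
    + revert Hphi; apply (theory_taut1 (mem_theory x)); tautology.
Qed.

Lemma mem_4 x phi : x (Box phi) -> x (Box (Box phi)).
Proof.
  apply (theory_mp (mem_theory x)), (theory_GL (mem_theory x)), GL_4.
Qed.

(** The second clause forces a new boxed formula of [L] to appear at each step, which excludes loops
    and infinite chains. *)
Definition canonical_acc : relation (complete_theory L) := fun x y =>
  (forall phi, In (Box phi) L -> x (Box phi) -> y phi /\ y (Box phi)) /\
  (exists phi, In (Box phi) L /\ ~ x (Box phi) /\ y (Box phi)).

Lemma canonical_acc_trans : transitive _ canonical_acc.
Proof.
  intros x y z [H1 (phi & Hin & Hx & Hy)] [H2 _]; split.
  - intros psi Hpsi Hb; apply H2, H1; auto.
  - exists phi; repeat split; auto; apply H2; auto.
Qed.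

(** Along a chain the number of boxed formulas of [L] missing from [x n], the ones selected by
    [f n], strictly decreases. *)
Lemma canonical_no_chain :
  ~ exists x : nat -> complete_theory L, forall n, canonical_acc (x n) (x (S n)).
Proof.
  intros [x Hx].
  set (f := fun n psi => decide (exists phi, psi = Box phi /\ ~ x n (Box phi))).
  assert (Hlt : forall n, length (filter (f (S n)) L) < length (filter (f n) L)).
  { intro n; destruct (Hx n) as [Hsub (phi & Hin & Hn & Hs)].
    apply filter_length_lt with (Box phi); auto; unfold f.
    - intros psi Hpsi; rewrite !decide_true; intros (chi & -> & H).
      exists chi; split; auto; intro Hc; now apply H, Hsub.
    - apply Bool.not_true_is_false; rewrite decide_true.
      intros (chi & [= <-] & H); auto.
    - apply decide_true; eauto. }
  assert (Hbound : forall n, length (filter (f n) L) + n <= length (filter (f 0) L)).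
  { induction n as [| n IH]; [lia | specialize (Hlt n); lia]. }
  specialize (Hbound (S (length (filter (f 0) L)))); lia.
Qed.

(** Extend the formulas necessary at [x] by the assumption [Box phi]. If this yielded [phi], then
    [x] would contain [Box (Imp (Box phi) phi)] and, by Löb's axiom, [Box phi]. The assumption is
    itself the new boxed formula that [canonical_acc] asks for. *)
Lemma canonical_witness x phi : In (Box phi) L -> ~ x (Box phi) ->
  exists y, canonical_acc x y /\ ~ y phi.
Proof.
  intros Hin Hn.
  pose proof (theory_unbox (mem_theory x)) as HU.
  destruct (@theory_extend L _ phi (theory_assume (Box phi) HU))
    as (y & Hsub & Hy).
  { intro H; apply Hn; revert H.
    apply (theory_mp (mem_theory x)), (theory_GL (mem_theory x)), GL_Lob. }
  exists y; split; auto; split.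
  - intros psi _ Hpsi; split; apply Hsub.
    + revert Hpsi; apply (theory_taut1 HU); tautology.
    + apply mem_4 in Hpsi; revert Hpsi; apply (theory_taut1 HU); tautology.
  - exists phi; repeat split; auto.
    apply Hsub, (theory_taut HU); tautology.
Qed.

(* The root [x0] only serves to make the set of worlds non-empty. *)
Definition canonical_model (x0 : complete_theory L) : model PropVar :=
  Model (model_frame := Frame (inhabits x0) canonical_acc)
    (fun x p => decide (x (Var p))).

Lemma canonical_GL x0 : GL_frame (canonical_model x0).
Proof. split; [exact canonical_acc_trans | exact canonical_no_chain]. Qed.

End Canonical.

(** * Subformulas and the truth lemma *)

Fixpoint subformulas phi : list (formula PropVar) :=
  phi :: match phi with
         | Imp psi chi => subformulas psi ++ subformulas chi
         | Box psi => subformulas psi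
         | _ => []
         end.

Lemma subformulas_self phi : In phi (subformulas phi).
Proof. destruct phi; simpl; auto. Qed.

Lemma subformulas_Imp L phi psi : List.incl (subformulas (Imp phi psi)) L ->
  List.incl (subformulas phi) L /\ List.incl (subformulas psi) L.
Proof.
  intro H; split; intros chi Hchi; apply H; right; apply in_or_app; auto.
Qed.

Lemma subformulas_Box L phi : List.incl (subformulas (Box phi)) L ->
  List.incl (subformulas phi) L.
Proof. intros H chi Hchi; apply H; right; exact Hchi. Qed.

Lemma subformulas_trans phi psi : In psi (subformulas phi) ->
  List.incl (subformulas psi) (subformulas phi).
Proof.
  induction phi as [p | | phi1 IH1 phi2 IH2 | phi IH]; intros [<- | Hin];
    try apply incl_refl; try contradiction; apply incl_tl.
  - apply in_app_or in Hin as [Hin | Hin];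
      [apply incl_appl | apply incl_appr]; auto.
  - auto.
Qed.

Lemma canonical_truth L (x0 : complete_theory L) phi :
  List.incl (subformulas phi) L ->
  forall x : canonical_model x0, true_at x phi <-> mem x phi.
Proof.
  induction phi as [p | | phi IHphi psi IHpsi | phi IH]; intros HL x.
  - apply decide_true.
  - split; [contradiction | exact (@mem_consistent L x)].
  - apply subformulas_Imp in HL as [Hphi Hpsi]; simpl.
    rewrite (@mem_Imp L x phi psi (Hphi _ (subformulas_self phi))), IHphi, IHpsi; tauto.
  - pose proof (HL _ (subformulas_self _)) as Hin.
    apply subformulas_Box in HL; split.
    + intro H; apply NNPP; intro Hn.
      destruct (canonical_witness Hin Hn) as (y & Hxy & Hy).
      apply Hy, (IH HL y), (H y Hxy).
    + intros H y Hxy; apply (IH HL y), (proj1 Hxy phi Hin H).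
Qed.

(** * Constant extensions *)

(** [M] is a generated submodel of [N]: by [acc_incl] its worlds see nothing new. *)
Lemma true_at_incl lambda (M N : model PropVar)
    (X : model_extension lambda M N) phi (x : M) :
  true_at (incl X x) phi <-> true_at x phi.
Proof.
  revert x; induction phi as [p | | phi IHphi psi IHpsi | phi IH]; intro x; simpl.
  - rewrite (ext_val X); tauto.
  - tauto.
  - rewrite IHphi, IHpsi; tauto.
  - split.
    + intros H x' Hx; apply IH, H, acc_incl; eauto.
    + intros H z Hz; apply acc_incl in Hz as (x' & Hx & ->); apply IH; auto.
Qed.

Section Tail.
Variables (lambda : limit_ordinal) (M N : model PropVar).
Variables (X : model_extension lambda M N) (L : list (formula PropVar)).
Hypothesis X_constant : constant_extension X.
Hypothesis node0_refl : forall phi, In (Box phi) L ->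
  true_at (node0 X) (Box phi) -> true_at (node0 X) phi.

(** [t_a] sees the successors of [t_0] and the earlier nodes. The latter agree with [t_0] on [phi],
    and [node0_refl] makes [phi] true at [t_0] once [Box phi] is. *)
Lemma true_at_node_Box phi (a : ord_upto lambda) :
  In (Box phi) L -> upto_lt (upto_zero lambda) a ->
  (forall b, upto_lt b (upto_top lambda) ->
     true_at (node X b) phi <-> true_at (node0 X) phi) ->
  true_at (node X a) (Box phi) <-> true_at (node0 X) (Box phi).
Proof.
  intros Hin Ha IH; split.
  - intros H x Hx; apply (true_at_incl X), H, (acc_node X _ Ha); eauto.
  - intros H z Hz.
    apply (acc_node X _ Ha) in Hz as [(b & Hb & ->) | (x & Hx & ->)].
    + apply IH; auto; destruct a as [a|], b as [b|]; simpl in *; auto.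
    + apply (true_at_incl X); auto.
Qed.

Lemma true_at_tail phi : List.incl (subformulas phi) L ->
  forall a, upto_lt a (upto_top lambda) ->
  true_at (node X a) phi <-> true_at (node0 X) phi.
Proof.
  induction phi as [p | | phi IHphi psi IHpsi | phi IH]; intros HL a Ha.
  - simpl; rewrite (X_constant p Ha (b := upto_zero lambda) I).
    rewrite node_zero, (ext_val X); tauto.
  - simpl; tauto.
  - apply subformulas_Imp in HL as [Hphi Hpsi]; simpl.
    rewrite IHphi, IHpsi; tauto.
  - pose proof (HL _ (subformulas_self _)) as Hin.
    apply subformulas_Box in HL.
    destruct (upto_zero_or_pos a) as [-> | Hpos].
    + rewrite node_zero; apply (true_at_incl X).
    + apply true_at_node_Box; auto.
Qed.

(** Constancy leaves the variables at the bottom free, so agreement with [t_0] is claimed only for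
    boxed formulas, which depend on the successors alone. *)
Lemma true_at_bottom_Box phi : List.incl (subformulas (Box phi)) L ->
  true_at (bottom X) (Box phi) <-> true_at (node0 X) (Box phi).
Proof.
  intro HL; apply true_at_node_Box; [apply HL, subformulas_self | exact I |].
  apply true_at_tail, (subformulas_Box HL).
Qed.

End Tail.

(** * A constant extension with prescribed [t_0] and prescribed variables at the bottom *)

Section Construction.
Variables (lambda : limit_ordinal) (M : model PropVar) (t0 : M).
Variable V : PropVar -> bool.

(** Index zero is left out of the second summand because [t_0] is already a world of [M]. *)
Definition ext_world : Type :=
  (M + {a : ord_upto lambda | upto_lt (upto_zero lambda) a})%type.

Definition ext_node (a : ord_upto lambda) : ext_world :=
  match excluded_middle_informative (upto_lt (upto_zero lambda) a) with
  | left Ha => inr (exist _ a Ha)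
  | right _ => inl t0
  end.

Lemma ext_node_pos (a : ord_upto lambda) (Ha : upto_lt (upto_zero lambda) a) :
  ext_node a = inr (exist _ a Ha).
Proof.
  unfold ext_node; destruct excluded_middle_informative; [| tauto].
  do 2 f_equal; apply proof_irrelevance.
Qed.

Lemma ext_node_zero : ext_node (upto_zero lambda) = inl t0.
Proof.
  unfold ext_node; destruct excluded_middle_informative as [H |]; auto.
  destruct (ord_zero_least H).
Qed.

Definition ext_rel : relation ext_world := fun y z =>
  (exists x x' : M, acc x x' /\ y = inl x /\ z = inl x') \/
  (exists a b, upto_lt b a /\ y = ext_node a /\ z = ext_node b) \/
  (exists a (x : M), upto_lt (upto_zero lambda) a /\ acc t0 x /\
     y = ext_node a /\ z = inl x).

Definition constant_model : model PropVar :=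
  Model (model_frame := Frame (inhabits (inl t0 : ext_world)) ext_rel)
    (fun y p => match y with
       | inl x => val x p
       | inr (exist _ (Some _) _) => val t0 p
       | inr (exist _ None _) => V p
     end).

(** The equations expose the components of an extension whose construction is opaque. *)
Lemma constant_frame_extension :
  {X : frame_extension lambda M constant_model |
    incl X = inl /\ node0 X = t0 /\ node X = ext_node}.
Proof.
  unshelve eexists (@Build_frame_extension lambda M constant_model
    inl t0 ext_node _ _ _ _ _ _).
  - exact ext_node_zero.
  - intros x x' [= E]; exact E.
  - intros a b.
    destruct (upto_zero_or_pos a) as [-> | Ha], (upto_zero_or_pos b) as [-> | Hb];
      rewrite ?ext_node_zero, ?(ext_node_pos Ha), ?(ext_node_pos Hb); congruence.
  - intros a x Ha; rewrite (ext_node_pos Ha); discriminate.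
  - intros [x | [a Ha]]; [left; eauto | right].
    exists a; split; auto; symmetry; apply ext_node_pos.
  - intros y z; apply iff_refl.
  - auto.
Qed.

Lemma constant_extension_exists :
  exists (N : model PropVar) (X : model_extension lambda M N),
    constant_extension X /\ node0 X = t0 /\
    forall p, val (bottom X) p = V p.
Proof.
  destruct constant_frame_extension as [X (HI & H0 & HN)].
  assert (Hval : forall (x : M) p, val (incl X x) p = val x p).
  { rewrite HI; reflexivity. }
  exists constant_model, (Build_model_extension Hval); split; [| split].
  - assert (Htail : forall p a, upto_lt a (upto_top lambda) ->
      val (node X a) p = val t0 p).
    { rewrite HN; intros p [a|] Ha; [| contradiction].
      destruct (upto_zero_or_pos (Some a)) as [-> | Hpos].
      - rewrite ext_node_zero; reflexivity.
      - rewrite (ext_node_pos Hpos); reflexivity. }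
    intros p a b Ha Hb; exact (eq_trans (Htail p a Ha) (eq_sym (Htail p b Hb))).
  - exact H0.
  - intro p; change (val (node X (upto_top lambda)) p = V p); rewrite HN.
    rewrite (@ext_node_pos (upto_top lambda) I); reflexivity.
Qed.

End Construction.

(** * Completeness *)

Lemma D_complete_pair phi : ~ D_H phi ->
  exists w v : complete_theory (subformulas phi),
    ~ w phi /\
    forall psi, In (Box psi) (subformulas phi) ->
      (w (Box psi) <-> v (Box psi)) /\ (v (Box psi) -> v psi).
Proof.
  intro Hphi; set (L := subformulas phi).
  destruct (@theory_extend L _ phi theory_D_H Hphi) as (w & HD & Hw).
  (* [S] collects the [chi] for which [Box chi] is a subformula of [phi] outside [w]. *)
  set (S := flat_map (fun psi => match psi with
              | Box chi => if decide (w (Box chi)) then [] else [chi]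
              | _ => [] end) L).
  assert (HS : forall psi, In psi S <-> In (Box psi) L /\ ~ w (Box psi)).
  { intro psi; unfold S; rewrite in_flat_map.
    rewrite <- (decide_true (w (Box psi))); split.
    - intros ([p | | a b | chi] & Hin & H); simpl in H; try tauto.
      destruct (decide (w (Box chi))) eqn:E; simpl in H; [tauto |].
      destruct H as [<- | []]; rewrite E; split; auto; discriminate.
    - intros [Hin H]; exists (Box psi); split; auto.
      destruct (decide (w (Box psi))); simpl; tauto. }
  assert (Hbox : ~ w (Box (box_disj S))).
  { intro H; apply (theory_mp (mem_theory w) (HD _ (D_box_disj S))) in H.
    revert H; apply theory_box_disj; [apply mem_theory | apply mem_consistent |].
    intros psi Hpsi; apply HS in Hpsi as [Hin Hn]; now apply mem_Neg. }
  destruct (theory_extend L (theory_unbox (mem_theory w)) Hbox)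
    as (v & Hsub & Hv).
  exists w, v; split; auto; intros psi Hin.
  assert (Hiff : w (Box psi) <-> v (Box psi)).
  (* Boxes pass from [w] to [v] by [mem_4]; conversely, a box in [v] but not in [w] would be a
     disjunct of [box_disj S], which [v] omits. *)
  { split.
    - intro H; apply Hsub, mem_4, H.
    - intro H; apply NNPP; intro Hn; apply Hv.
      apply (box_disj_intro (mem_theory v) (proj2 (HS psi) (conj Hin Hn)) H). }
  split; auto; intro H; apply Hsub, Hiff, H.
Qed.

Lemma D_complete (lambda : limit_ordinal) phi :
  (forall (M N : model PropVar) (X : model_extension lambda M N),
     GL_frame M -> constant_extension X -> true_at (bottom X) phi) ->
  D_H phi.
Proof.
  intro H; apply NNPP; intro Hn.
  destruct (D_complete_pair Hn) as (w & v & Hw & Hwv).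
  set (M := canonical_model v).
  (* The extension is grown from [v] as [t_0], while the bottom takes its variables from [w]. *)
  destruct (@constant_extension_exists lambda M v (fun p => decide (w (Var p))))
    as (N & X & HX & H0 & HV).
  apply Hw.
  assert (Htruth : forall psi, List.incl (subformulas psi) (subformulas phi) ->
    true_at (node0 X) psi <-> v psi).
  { rewrite H0; intros psi Hpsi; exact (canonical_truth (x0 := v) Hpsi v). }
  enough (Hbot : forall psi, List.incl (subformulas psi) (subformulas phi) ->
    true_at (bottom X) psi <-> w psi).
  { apply (Hbot phi (incl_refl _)), H; auto; apply canonical_GL. }
  assert (Hrefl : forall psi, In (Box psi) (subformulas phi) ->
    true_at (node0 X) (Box psi) -> true_at (node0 X) psi).
  { intros psi Hin; pose proof (subformulas_trans Hin) as HL.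
    rewrite (Htruth _ HL), (Htruth _ (subformulas_Box HL)); now apply Hwv. }
  induction psi as [p | | psi IHpsi chi IHchi | psi _]; intro HL.
  - simpl; rewrite HV; apply decide_true.
  - split; [contradiction | exact (@mem_consistent _ w)].
  - apply subformulas_Imp in HL as [Hpsi Hchi].
    rewrite (mem_Imp w chi (Hpsi _ (subformulas_self psi))).
    rewrite <- (IHpsi Hpsi), <- (IHchi Hchi); apply iff_refl.
  (* Boxed subformulas have the same value at the bottom as at [t_0], hence as in [v], hence as in
     [w]. *)
  - rewrite (true_at_bottom_Box HX Hrefl HL), (Htruth _ HL).
    symmetry; apply Hwv, HL, subformulas_self.
Qed.

End Theories.

Theorem proposition2p7 (PropVar : Type) (lambda : limit_ordinal)
    (phi : formula PropVar) :
  let d1 := D_H phi in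
  let d2 := forall (M N : model PropVar) (X : model_extension lambda M N),
    GL_frame M -> constant_extension X -> true_at (bottom X) phi in
  let d3 := forall (M N : model PropVar) (X : model_extension lambda M N),
    GL_frame M -> true_at (bottom X) phi in
  (d1 <-> d2) /\ (d2 <-> d3).
Proof.
  intros d1 d2 d3.
  assert (d1 -> d3) by (intros H M N X HM; exact (D_sound X HM H)).
  assert (d3 -> d2) by (intros H' M N X HM _; exact (H' M N X HM)).
  assert (d2 -> d1) by exact (@D_complete PropVar lambda phi).
  tauto.
Qed.
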